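(* Let $H$ be a complex Hilbert space, let $T\in B(H)$, let $S\subset\mathbb{C}$ and $z_0\in S$, and suppose that $(S,z_0)$ is a $W$-spectral pair for $T$. If $f$ is a rational function such that $f(S)\subset\overline{\mathbb{D}}$, then $W(f(T))\subset t(f(z_0))$.
   Context: $B(H)$ is the algebra of bounded linear operators on $H$, $\sigma(T)$ is the spectrum of $T$, and $\mathbb{D}$ is the open unit disk in $\mathbb{C}$. The numerical range and numerical radius of $T\in B(H)$ are $W(T):=\{\langle Tx,x\rangle: x\in H,\ \|x\|=1\}$ and $w(T):=\sup_{z\in W(T)}|z|$. Definition ($W$-spectral pair). Let $T\in B(H)$, let $S\subset\mathbb{C}$ and let $z_0\in S$. The pair $(S,z_0)$ is a $W$-spectral pair for $T$ if $\sigma(T)\subset S$ and if, for every rational function $f$ with poles outside $\overline{S}$ and satisfying $f(z_0)=0$, we have $w(f(T))\le\sup_{z\in S}|f(z)|$. For $a\in\overline{\mathbb{D}}$, the 'teardrop' set $t(a)$ is the convex hull of the union of closed disks $\overline{D}(0,1)\cup\overline{D}(a,1-|a|^2)$, where $\overline{D}(c,r)$ is the closed disk of centre $c$ and radius $r$. *)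

(* Defs.v *)
From HB Require Import structures.
From mathcomp Require Export all_boot all_order all_algebra.
From mathcomp Require Export sesquilinear fraction generic_quotient complex.
From mathcomp Require Export all_classical all_reals all_analysis.

Set Implicit Arguments.
Unset Strict Implicit.
Unset Printing Implicit Defensive.

Import Order.TTheory GRing.Theory Num.Theory.
Export numFieldNormedType.Exports.

Open Scope classical_set_scope.
Open Scope complex_scope.
Open Scope ring_scope.

(** The ordering of [R[i]] is the partial one: [x <= y] means that [y - x] is
    a nonnegative real, so a bound [`|z| <= r] entails that [r] is real. *)

Section RationalFunctions.
Variable R : realType.
Local Notation C := R[i].
Implicit Types (f : {fraction {poly C}}) (z : C).

(* [repr f] is an arbitrary representative of [f], not necessarily in lowest
   terms, whence the division by the gcd. *)
Definition rat_num f : {poly C} :=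
  (frac (repr f)).1 %/ gcdp (frac (repr f)).1 (frac (repr f)).2.

Definition rat_den f : {poly C} :=
  (frac (repr f)).2 %/ gcdp (frac (repr f)).1 (frac (repr f)).2.

Definition pole f z : Prop := root (rat_den f) z.

(* Meaningful only when [z] is not a pole of [f]. *)
Definition rat_eval f z : C := (rat_num f).[z] / (rat_den f).[z].

(* The inclusion [f(S) `<=` D] for [D] a subset of the (finite) plane: in
   particular [f] takes the value infinity nowhere on [S]. *)
Definition rat_maps f (S D : set C) : Prop :=
  forall z, S z -> ~ pole f z /\ D (rat_eval f z).

End RationalFunctions.

Section Operators.
Variables (R : realType) (H : completeNormedModType R[i]).
Local Notation C := R[i].
Implicit Types (A T : H -> H) (z : C).

Definition bounded_inverse A (B : {linear H -> H}) : Prop :=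
  [/\ continuous B, cancel A B & cancel B A].

Definition spectrum T : set C :=
  [set z | ~ exists B : {linear H -> H},
               bounded_inverse (fun x => T x - z *: x) B].

Definition poly_op T (p : {poly C}) : H -> H :=
  fun x => \sum_(k < size p) p`_k *: iter k T x.

(* The inverse of [A] when [A] is bijective; a junk value outside the range
   of [A]. *)
Definition op_inv A : H -> H := fun x => xget 0 [set y | A y = x].

(* Meaningful when no pole of [f] lies in the spectrum of [T], in which case
   [poly_op T (rat_den f)] is invertible. *)
Definition rat_op f T : H -> H :=
  fun x => poly_op T (rat_num f) (op_inv (poly_op T (rat_den f)) x).

Variable ip : {dot H for (@Num.conj C)}.

Definition numerical_range T : set C :=
  [set z | exists2 x : H, `|x| = 1 & z = ip (T x) x].

Definition sup_norm (S : set C) (g : C -> C) : \bar R :=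
  ereal_sup [set (complex.Re `|g z|)%:E | z in S].

(* If [H] is the zero space, [numerical_range T] is empty and this is [-oo]. *)
Definition numerical_radius T : \bar R := sup_norm (numerical_range T) id.

Definition W_spectral_pair T (S : set C) (z0 : C) : Prop :=
  spectrum T `<=` S /\
  forall f : {fraction {poly C}},
    (forall z, pole f z -> ~ closure (S : set C^o) z) ->
    rat_eval f z0 = 0 ->
    (numerical_radius (rat_op f T) <= sup_norm S (rat_eval f))%E.

End Operators.

Section Teardrop.
Variable R : realType.
Local Notation C := R[i].

(* Unlike the closure of [ball c r], this is [set1 c] when [r = 0]. *)
Definition closed_disk (c r : C) : set C := closed_ball_ Num.norm c r.

(* The weights of [convex_set] range over the [t : C] with [0 <= t <= 1],
   which are real: this is ordinary convexity in the plane. *)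
Definition convex_hull (A : set C) : set C :=
  \bigcap_(K in [set K : set C | convex_set (K : set C^o) /\ A `<=` K]) K.

Definition teardrop (a : C) : set C :=
  convex_hull (closed_disk 0 1 `|` closed_disk a (1 - `|a| ^+ 2)).

End Teardrop.

(* Main.v *)
Require Import Defs.
From mathcomp Require Import ring lra.
Import Order.TTheory GRing.Theory Num.Theory.

(** Write [f = n / d] in lowest terms, [a = f(z0)], and suppose [|a| < 1].
    The Moebius transform [g = (n - a d) / (d - a^* n)] of [f] maps [S] into
    the closed unit disk and vanishes at [z0], so [A := g(T)] has numerical
    radius at most [1], and [f(T) = (A + a)(1 + a^* A)^-1].  For a unit vector
    [x], put [p := <A x, x>]; then [|A x|^2 <= 2 + 2 sqrt (1 - |p|^2)]
    (Klaja, Mashreghi and Ransford), and with this bound the quotient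
    [<(A + a) x, (1 + a^* A) x> / |(1 + a^* A) x|^2] satisfies the inequality of
    each supporting line of the teardrop, by Cauchy-Schwarz.  If [|a| = 1], the
    teardrop is the unit disk; apply the above to [r f] and let [r] tend
    to [1]. *)

(** * Supporting lines of the teardrop *)

(* The teardrop is the union over [t] in [[0, 1]] of the closed disks of centre
   [t a] and radius [1 - t |a|^2].  The hypotheses say that [w] obeys the
   supporting inequality in each direction [v], of length [L]; the maximum of the
   two support functions changes branch at [v . a = |a|^2 L], and the right [t]
   is the one for which [w - t a] points in such a direction. *)
Lemma support_to_disk (R : realType) (a1 a2 w1 w2 : R) (A2 := a1 ^+ 2 + a2 ^+ 2) :
  A2 <= 1 ->
  (forall v1 v2 L : R, 0 <= L -> L ^+ 2 = v1 ^+ 2 + v2 ^+ 2 ->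
     v1 * a1 + v2 * a2 <= A2 * L -> v1 * w1 + v2 * w2 <= L) ->
  (forall v1 v2 L : R, 0 <= L -> L ^+ 2 = v1 ^+ 2 + v2 ^+ 2 ->
     A2 * L <= v1 * a1 + v2 * a2 ->
     v1 * w1 + v2 * w2 <= v1 * a1 + v2 * a2 + (1 - A2) * L) ->
  exists t : R, [/\ 0 <= t, t <= 1 &
    (w1 - t * a1) ^+ 2 + (w2 - t * a2) ^+ 2 <= (1 - t * A2) ^+ 2].
Proof.
move=> A2le H1 H2.
have A2ge : 0 <= A2 by rewrite addr_ge0 ?sqr_ge0.
pose L t : R := Num.sqrt ((w1 - t * a1) ^+ 2 + (w2 - t * a2) ^+ 2).
have L0 t : 0 <= L t by exact: sqrtr_ge0.
have L2 t : L t ^+ 2 = (w1 - t * a1) ^+ 2 + (w2 - t * a2) ^+ 2.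
  by rewrite sqr_sqrtr // addr_ge0 ?sqr_ge0.
have goalL t : L t <= 1 - t * A2 ->
    (w1 - t * a1) ^+ 2 + (w2 - t * a2) ^+ 2 <= (1 - t * A2) ^+ 2.
  by move=> h; rewrite -L2 lerXn2r ?nnegrE // (le_trans (L0 t)).
case: (leP (L 0) 1) => [h0|h0].
  by exists 0; split => //; apply: goalL; rewrite mul0r subr0.
case: (leP (L 1) (1 - A2)) => [h1|h1].
  by exists 1; split => //; apply: goalL; rewrite mul1r.
(* The sign of [k t] tells which hypothesis governs the direction v = w - t a of length [L t]. If
   [k 0 <= 0], [H1] would give [L 0 <= 1]; if [k 1 >= 0], [H2] would give [L 1 <= 1 - A2]. *)
pose k t := (w1 - t * a1) * a1 + (w2 - t * a2) * a2 - A2 * L t.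
have k0 : 0 < k 0.
  rewrite ltNge; apply/negP; rewrite /k => hk.
  have := H1 _ _ _ (L0 0) (L2 0); have := L2 0; nra.
have k1 : k 1 < 0.
  rewrite ltNge; apply/negP; rewrite /k => hk.
  have := H2 _ _ _ (L0 1) (L2 1); have := L2 1; nra.
have Lc : continuous L.
  move=> t; apply: continuous_cvg; first exact: sqrt_continuous.
  by apply: cvgD; rewrite !expr2; apply: cvgM; apply: cvgB; (try exact: cvg_cst);
     apply: cvgM => //; exact: cvg_cst.
have kc : continuous k.
  move=> t; apply: cvgB; last by apply: cvgM; [exact: cvg_cst | exact: Lc].
  by apply: cvgD; apply: cvgM; (try exact: cvg_cst); apply: cvgB;
     (try exact: cvg_cst); apply: cvgM => //; exact: cvg_cst.
have [] := @IVT R k 0 1 0 ler01.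
- by apply: continuous_subspaceT.
- by rewrite ge_min le_max (ltW k0) (ltW k1) orbT.
move=> t; rewrite in_itv /= => /andP[t0 t1] kt; exists t; split => //.
apply: goalL; have := H1 _ _ _ (L0 t) (L2 t).
have := L2 t; move: kt; rewrite /k; have := L0 t.
rewrite le_eqVlt => /orP[/eqP<- *|Lp kt e h]; first by nra.
have {}h := h ltac:(lra).
(* At a zero of [k], v . w = L^2 + t A2 L, so [H1] reads L^2 + t A2 L <= L; it remains to divide by
   L. *)
have : L t * (L t + t * A2 - 1) <= 0.
  have -> : L t * (L t + t * A2 - 1) = L t ^+ 2 + t * (A2 * L t) - L t by ring.
  have -> : A2 * L t = (w1 - t * a1) * a1 + (w2 - t * a2) * a2 by lra.
  by move: h; rewrite e; lra.
rewrite pmulr_rle0 //; lra.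
Qed.

(* [N] and [n1 + i n2] are [|(1 + a^* A) x|^2] and [<(A + a) x, (1 + a^* A) x>]
   for a unit vector [x], in terms of [p = <A x, x>] and [q = |A x|^2]. *)
Lemma mobius_support (R : realType) (a1 a2 p1 p2 q S : R)
    (A2 := a1 ^+ 2 + a2 ^+ 2) (P2 := p1 ^+ 2 + p2 ^+ 2)
    (N := 1 + 2 * (a1 * p1 + a2 * p2) + A2 * q)
    (n1 := p1 + a1 + a1 * q + ((a1 ^+ 2 - a2 ^+ 2) * p1 + 2 * a1 * a2 * p2))
    (n2 := p2 + a2 + a2 * q + (2 * a1 * a2 * p1 - (a1 ^+ 2 - a2 ^+ 2) * p2)) :
  A2 < 1 -> P2 <= q -> 0 <= S -> S ^+ 2 = 1 - P2 -> q <= 2 + 2 * S ->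
  0 < N ->
  exists t : R, [/\ 0 <= t, t <= 1 &
    (n1 / N - t * a1) ^+ 2 + (n2 / N - t * a2) ^+ 2 <= (1 - t * A2) ^+ 2].
Proof.
move=> A1 Pq S0 S2 qS N0.
have A0 : 0 <= A2 by rewrite addr_ge0 ?sqr_ge0.
have P0 : 0 <= P2 by rewrite addr_ge0 ?sqr_ge0.
apply: support_to_disk; first exact: ltW.
- move=> v1 v2 L L0 L2 hv; rewrite !mulrA -mulrDl ler_pdivrMr //.
  (* [z1 + i z2] is 1 + a^* p, and [y1 + i y2] below is p + a times its conjugate, the numerator at
     q = |p|^2. There the quotient has modulus at most 1; a larger q adds (q - P2) a to the
     numerator and (q - P2) A2 to [N]. *)
  pose z1 := 1 + a1 * p1 + a2 * p2; pose z2 := a1 * p2 - a2 * p1.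
  have hz : (p1 + a1) ^+ 2 + (p2 + a2) ^+ 2 <= z1 ^+ 2 + z2 ^+ 2.
    have : 0 <= (1 - A2) * (1 - P2).
      by apply: mulr_ge0; [rewrite subr_ge0 ltW | rewrite -S2 sqr_ge0].
    rewrite /z1 /z2 /A2 /P2; lra.
  pose Z := z1 ^+ 2 + z2 ^+ 2.
  pose y1 := (p1 + a1) * z1 + (p2 + a2) * z2.
  pose y2 := (p2 + a2) * z1 - (p1 + a1) * z2.
  have Z0 : 0 <= Z by rewrite addr_ge0 ?sqr_ge0.
  have hy : v1 * y1 + v2 * y2 <= L * Z.
    apply: (le_trans (ler_norm _)).
    rewrite -(@ler_pXn2r _ 2) ?nnegrE ?mulr_ge0 // real_normK ?num_real //.
    rewrite [leRHS]exprMn L2.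
    apply: (@le_trans _ _ ((v1 ^+ 2 + v2 ^+ 2) * (y1 ^+ 2 + y2 ^+ 2))).
      have := sqr_ge0 (v1 * y2 - v2 * y1); lra.
    rewrite ler_wpM2l ?addr_ge0 ?sqr_ge0 //.
    have -> : y1 ^+ 2 + y2 ^+ 2 = ((p1 + a1) ^+ 2 + (p2 + a2) ^+ 2) * Z.
      by rewrite /y1 /y2 /Z; ring.
    by rewrite expr2 ler_wpM2r.
  have hq : 0 <= (q - P2) * (A2 * L - (v1 * a1 + v2 * a2)).
    by rewrite mulr_ge0 // subr_ge0.
  rewrite -subr_ge0.
  have -> : L * N - (v1 * n1 + v2 * n2) =
      (L * Z - (v1 * y1 + v2 * y2)) + (q - P2) * (A2 * L - (v1 * a1 + v2 * a2)).
    by rewrite /N /n1 /n2 /Z /y1 /y2 /z1 /z2 /A2 /P2; ring.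
  by rewrite addr_ge0 // subr_ge0.
move=> v1 v2 L L0 L2 hv.
rewrite !mulrA -mulrDl ler_pdivrMr // -subr_ge0.
(* [b] is the excess in the branch condition [hv]. As it is nonnegative, q may be replaced by its
   upper bound 2 + 2 S. *)
pose b := v1 * a1 + v2 * a2 - A2 * L.
pose m := (2 * L * a1 - v1) * p1 + (2 * L * a2 - v2) * p2.
have -> : (v1 * a1 + v2 * a2 + (1 - A2) * L) * N - (v1 * n1 + v2 * n2)
   = (1 - A2) * (L + m - b * q).
  by rewrite /m /b /N /n1 /n2 /A2; ring.
rewrite mulr_ge0 ?subr_ge0 ?(ltW A1) //.
have b0 : 0 <= b by rewrite subr_ge0.
apply: (@le_trans _ _ (b * (2 + 2 * S))); first by rewrite ler_wpM2l.
have rho0 : (2 * L * a1 - v1) ^+ 2 + (2 * L * a2 - v2) ^+ 2 = L ^+ 2 - 4 * L * b.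
  rewrite /b; transitivity (4 * L ^+ 2 * A2 - 4 * L * (v1 * a1 + v2 * a2) +
    (v1 ^+ 2 + v2 ^+ 2)); last by rewrite -L2; ring.
  by rewrite /A2; ring.
(* [r] = |2 L a - v| and [s] = |p|, so that Cauchy-Schwarz bounds [m] below by - r s. *)
pose r := Num.sqrt (L ^+ 2 - 4 * L * b); pose s := Num.sqrt P2.
have r2 : r ^+ 2 = L ^+ 2 - 4 * L * b.
  by rewrite sqr_sqrtr // -rho0 addr_ge0 ?sqr_ge0.
have s2 : s ^+ 2 = P2 by rewrite sqr_sqrtr.
have r0 : 0 <= r by exact: sqrtr_ge0.
have s0 : 0 <= s by exact: sqrtr_ge0.
have hm : - m <= r * s.
  apply: (le_trans (ler_norm _)).
  rewrite normrN -(@ler_pXn2r _ 2) ?nnegrE ?mulr_ge0 // real_normK ?num_real //.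
  rewrite [leRHS]exprMn r2 s2 -rho0 /m /P2.
  have := sqr_ge0 ((2 * L * a1 - v1) * p2 - (2 * L * a2 - v2) * p1); lra.
have bL : 4 * b <= L.
  move: L0; rewrite le_eqVlt => /orP[/eqP L00|Lp].
    have v0 : v1 ^+ 2 + v2 ^+ 2 = 0 by rewrite -L2 -L00 expr0n.
    have [v10 v20] : v1 = 0 /\ v2 = 0.
      by move/eqP: v0; rewrite paddr_eq0 ?sqr_ge0 // !sqrf_eq0 => /andP[/eqP-> /eqP->].
    by rewrite /b -L00 v10 v20 !mul0r mulr0 addr0 subr0 mulr0.
  have : 0 <= L * (L - 4 * b) by rewrite mulrBr; have := sqr_ge0 r; rewrite r2; lra.
  by rewrite pmulr_rge0 // subr_ge0.
(* Cauchy-Schwarz for (2 b, r) and (S, s): the second is a unit vector and the first has length L -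
   2 b. *)
suff h : 2 * b * S + r * s <= L - 2 * b.
  by clearbody b m r s; clear -h hm; lra.
have l0 : 0 <= 2 * b * S + r * s by rewrite addr_ge0 // !mulr_ge0.
have u0 : 0 <= L - 2 * b by clearbody b; clear -bL b0; lra.
rewrite -(@ler_pXn2r _ 2) ?nnegrE //.
have -> : (L - 2 * b) ^+ 2 = (4 * b ^+ 2 + r ^+ 2) * (S ^+ 2 + s ^+ 2).
  by rewrite S2 s2 r2; ring.
have := sqr_ge0 (2 * b * s - r * S); lra.
Qed.

(** * The bound on |A x| for numerical radius at most one *)

(* [D] is [|A x - P x|^2] where [P = <A x, x>] is real: the first family of
   inequalities bounds the real part of [A], the second its imaginary part. *)
Lemma defect_bound (R : realType) (P D m g h : R) : -1 <= P <= 1 -> 0 <= D ->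
  (forall t, `|P + t * (D + m) + t ^+ 2 * g| <= 1 + t ^+ 2 * D) ->
  (forall t, `|t * (m - D) + t ^+ 2 * h| <= 1 + t ^+ 2 * D) ->
  D <= (1 + Num.sqrt (1 - P ^+ 2)) ^+ 2.
Proof.
move=> /andP[P0 P1] D0 H1 H2.
(* Discriminant of a nonnegative quadratic, with no sign assumed on z: z < 0 is contradictory and z
   = 0 forces y = 0. *)
have discr (x y z : R) : (forall t, 0 <= x + t * y + t ^+ 2 * z) -> y ^+ 2 <= 4 * (x * z).
  move=> H.
  have x0 : 0 <= x by have := H 0; rewrite mul0r expr0n /= mul0r !addr0.
  have [z0|z0|z0] := ltgtP z 0.
  - have := H (Num.sqrt ((x + 1) / - z)); have := H (- Num.sqrt ((x + 1) / - z)).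
    have zn : 0 <= (x + 1) / - z by rewrite divr_ge0 ?oppr_ge0 ?(ltW z0) // addr_ge0.
    rewrite sqrrN sqr_sqrtr //.
    have -> : (x + 1) / - z * z = - (x + 1) by field; rewrite ?oppr_eq0 lt_eqF.
    lra.
  - have := H (- y / (2 * z)).
    have -> : x + - y / (2 * z) * y + (- y / (2 * z)) ^+ 2 * z = (4 * (x * z) - y ^+ 2) / (4 * z).
      by field; rewrite gt_eqF.
    by rewrite pmulr_lge0 ?subr_ge0 // invr_gt0 mulr_gt0.
  - have [->|y0] := eqVneq y 0; first by rewrite z0 expr0n /= mulr0 mulr0.
    have := H (- (x + 1) / y).
    have -> : x + - (x + 1) / y * y + (- (x + 1) / y) ^+ 2 * z = -1 by rewrite z0; field.
    by rewrite lerNr oppr0 ler10.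
have E1 : (D + m) ^+ 2 <= 4 * ((1 - P) * (D - g)).
  rewrite -sqrrN; apply: discr => t; have := H1 t; rewrite ler_norml => /andP[_]; lra.
have E2 : (D + m) ^+ 2 <= 4 * ((1 + P) * (D + g)).
  apply: discr => t; have := H1 t; rewrite ler_norml => /andP[+ _]; lra.
(* Comparing the bounds at t and - t eliminates [h]. *)
have E3 : (D - m) ^+ 2 <= 4 * (1 * D).
  apply: discr => t; have := H2 t; have := H2 (- t).
  rewrite sqrrN !ler_norml => /andP[a b] /andP[c d]; lra.
have S0 : 0 <= Num.sqrt (1 - P ^+ 2) by exact: sqrtr_ge0.
have S2 : Num.sqrt (1 - P ^+ 2) ^+ 2 = 1 - P ^+ 2 by rewrite sqr_sqrtr //; nra.
set s := Num.sqrt _ in S0 S2 *.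
have d0 : 0 <= Num.sqrt D by exact: sqrtr_ge0.
have d2 : Num.sqrt D ^+ 2 = D by rewrite sqr_sqrtr.
set d := Num.sqrt D in d0 d2 *.
(* Weighting [E1] by 1 + P and [E2] by 1 - P eliminates [g]. *)
have E4 : D + m <= 2 * (s * d).
  apply: (le_trans (ler_norm _)).
  rewrite -(@ler_pXn2r _ 2) ?nnegrE ?mulr_ge0 // real_normK ?num_real //.
  rewrite !exprMn S2 d2.
  have : 0 <= (1 + P) * (4 * ((1 - P) * (D - g)) - (D + m) ^+ 2).
    by rewrite mulr_ge0 ?subr_ge0 //; lra.
  have : 0 <= (1 - P) * (4 * ((1 + P) * (D + g)) - (D + m) ^+ 2).
    by rewrite mulr_ge0 ?subr_ge0 //; lra.
  lra.
have E5 : D - m <= 2 * d.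
  apply: (le_trans (ler_norm _)).
  rewrite -(@ler_pXn2r _ 2) ?nnegrE ?mulr_ge0 // real_normK ?num_real //.
  by rewrite exprMn d2; lra.
(* The sum of [E4] and [E5] eliminates [m]. *)
have : d * (1 + s - d) >= 0 by rewrite mulrBr -expr2 d2; lra.
rewrite -d2; move: d0; rewrite le_eqVlt => /orP[/eqP<- _|dp].
  by rewrite expr0n /= sqr_ge0.
rewrite pmulr_rge0 // subr_ge0 => dS.
by rewrite lerXn2r ?nnegrE ?addr_ge0 ?(ltW dp).
Qed.

Lemma normc_le_ReIm (R : realType) (z : R[i]) (c : R) : `|z| <= c%:C ->
  `|complex.Re z| <= c /\ `|complex.Im z| <= c.
Proof.
case: z => x y; rewrite normc_def lecR /= => h.
split; apply: le_trans h; rewrite -sqrtr_sqr ler_wsqrtr //.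
  by rewrite lerDl sqr_ge0.
by rewrite lerDr sqr_ge0.
Qed.

Lemma conjC_realC (R : realType) (x : R) : Num.conj x%:C = x%:C.
Proof. exact: conjc_real. Qed.

Section Form.
Variables (R : realType) (U : lmodType R[i]) (ip : {dot U for (@Num.conj R[i])}).

Lemma dotC u v : ip u v = (ip v u)^*.
Proof. by rewrite hermC mul1r. Qed.

Lemma dotDl u v w : ip (u + v) w = ip u w + ip v w.
Proof. exact: linearDl. Qed.
Lemma dotDr u v w : ip w (u + v) = ip w u + ip w v.
Proof. exact: linearDr. Qed.
Lemma dotZl (a : R[i]) u v : ip (a *: u) v = a * ip u v.
Proof. exact: linearZl_LR. Qed.
Lemma dotZr (a : R[i]) u v : ip u (a *: v) = a^* * ip u v.
Proof. exact: linearZr_LR. Qed.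
Definition dotE := (dotDl, dotDr, dotZl, dotZr).

(** Split A x = v + P x with v orthogonal to x, and test the numerical range hypothesis on the
    vectors x + l v. This bounds |v|^2 by (1 + s)^2 with s^2 = 1 - P^2, and (1 + s)^2 + P^2 = 2 + 2
    s. *)
Lemma real_numrange_bound (A : U -> U) (x : U) (P : R) :
  (forall c u v, A (c *: u + v) = c *: A u + A v) ->
  (forall u, `|ip (A u) u| <= ip u u) ->
  ip x x = 1 -> ip (A x) x = P%:C ->
  P ^+ 2 <= 1 /\
  P ^+ 2 <= complex.Re (ip (A x) (A x)) <= 2 + 2 * Num.sqrt (1 - P ^+ 2).
Proof.
move=> Alin Aw x1 AxP.
have [v Axv] : exists v, A x = v + P%:C *: x.
  by exists (A x - P%:C *: x); rewrite subrK.
pose D := complex.Re (ip v v).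
have vx : ip v x = 0.
  by have := AxP; rewrite Axv !dotE x1 mulr1 => /(canRL (addrK _)); rewrite subrr.
have xv : ip x v = 0 by rewrite dotC vx rmorph0.
have vv : ip v v = D%:C by rewrite RRe_real // ger0_real ?dnorm_ge0.
have D0 : 0 <= D by rewrite -lecR -vv dnorm_ge0.
have AxAx : ip (A x) (A x) = (D + P ^+ 2)%:C.
  rewrite Axv !dotE vx xv x1 vv conjC_realC.
  by rewrite !mulr0 addr0 add0r mulr1 rmorphD rmorphXn.
have Pb : -1 <= P <= 1.
  by have := Aw x; rewrite AxP x1 => /normc_le_ReIm[/=]; rewrite ler_norml.
have P1 : P ^+ 2 <= 1 by nra.
have key (l : R[i]) :
    `|P%:C + l^* * D%:C + l * (ip (A v) x) + l * l^* * ip (A v) v| <= 1 + l * l^* * D%:C.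
  have := Aw (l *: v + x).
  rewrite Alin !dotE AxP Axv !dotE xv vx vv x1.
  by rewrite /=; congr (`|_| <= _); ring.
have {key} [m [g [h [H1 H2]]]] : exists m g h : R,
    (forall t, `|P + t * (D + m) + t ^+ 2 * g| <= 1 + t ^+ 2 * D) /\
    (forall t, `|t * (m - D) + t ^+ 2 * h| <= 1 + t ^+ 2 * D).
  move: (ip (A v) x) (ip (A v) v) key => [m1 m2] [g1 g2] key.
  (* The real part for l = t and the imaginary part for l = i t both involve <A v, x> only through
     its real part [m1]. *)
  exists m1, g1, g2; split=> t.
    have := key t%:C.
    have -> : 1 + t%:C * t%:C^* * D%:C = (1 + t ^+ 2 * D)%:C.
      by rewrite conjC_realC rmorphD rmorphM rmorphXn expr2 rmorph1.
    rewrite conjC_realC => /normc_le_ReIm[+ _]; simpc.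
    by rewrite /=; congr (`|_| <= _); ring.
  have cti : (t *i)^* = (- t) *i by [].
  have := key (t *i); rewrite cti.
  have -> : 1 + t *i * (- t) *i * D%:C = (1 + t ^+ 2 * D)%:C.
    by apply/eqP; rewrite eq_complex /=; apply/andP; split; apply/eqP => /=; ring.
  move=> /normc_le_ReIm[_ +]; simpc.
  by rewrite /=; congr (`|_| <= _); ring.
have := defect_bound _ _ _ _ _ _ Pb D0 H1 H2.
set s := Num.sqrt _ => Ds.
have s2 : s ^+ 2 = 1 - P ^+ 2 by rewrite sqr_sqrtr // subr_ge0.
split=> //; rewrite AxAx /=; apply/andP; split; first by rewrite lerDr.
by move: Ds; clear -s2; nra.
Qed.


Lemma numrange_bound (A : U -> U) (x : U) (p : R[i]) (P2 : R) :
  (forall c u v, A (c *: u + v) = c *: A u + A v) ->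
  (forall u, `|ip (A u) u| <= ip u u) ->
  ip x x = 1 -> ip (A x) x = p ->
  P2 = complex.Re p ^+ 2 + complex.Im p ^+ 2 ->
  P2 <= 1 /\ P2 <= complex.Re (ip (A x) (A x)) <= 2 + 2 * Num.sqrt (1 - P2).
Proof.
move=> Alin Aw x1 Axp P2E.
have P20 : 0 <= P2 by rewrite P2E addr_ge0 ?sqr_ge0.
(* Rotating [A] by a unimodular [z] makes [p] real. *)
have [z [z1 zp]] : exists z : R[i], z * z^* = 1 /\ z * p = (Num.sqrt P2)%:C.
  have [p0|p0] := eqVneq p 0.
    exists 1; rewrite rmorph1 mul1r; split=> //.
    by rewrite mul1r P2E p0 /= expr0n /= addr0 sqrtr0.
  have pn : (Num.sqrt P2)%:C = `|p| by rewrite normc_def P2E.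
  exists (p^* / `|p|); rewrite pn.
  have n0 : `|p| != 0 by rewrite normr_eq0.
  split.
    rewrite rmorphM fmorphV /= conj_normC conjCK mulrACA [_ * p]mulrC -normCK.
    by rewrite -invfM -expr2 divff // expf_neq0.
  by rewrite mulrAC [_ * p]mulrC -normCK expr2 mulfK.
have q1 u v : ip (z *: u) (z *: v) = ip u v by rewrite !dotE mulrA z1 mul1r.
have := real_numrange_bound (fun u => z *: A u) x (Num.sqrt P2).
rewrite sqr_sqrtr //= q1; apply=> //.
- by move=> c u v; rewrite Alin scalerDr !scalerA mulrC.
- move=> u; rewrite dotE normrM.
  suff -> : `|z| = 1 by rewrite mul1r.
  by apply/eqP; rewrite -(@eqrXn2 _ 2) // expr1n normCK z1.
- by rewrite dotE Axp.
Qed.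

End Form.

(** * Moebius transforms of an operator and the teardrop *)

(** Such a point is t a + (1 - t |a|^2) u with |u| <= 1, the combination with weights t and 1 - t of
    a + (1 - |a|^2) u and u, which lie in the two generating disks. *)
Lemma teardrop_disk (R : realType) (a w : R[i]) (t : R) :
  `|a| < 1 -> 0 <= t -> t <= 1 ->
  `|w - t%:C * a| <= 1 - t%:C * `|a| ^+ 2 -> teardrop a w.
Proof.
move=> a1 t0 t1 hw K [Kc KD].
pose r : R[i] := 1 - t%:C * `|a| ^+ 2.
have tC0 : 0 <= t%:C :> R[i] by rewrite ler0c.
have tC1 : t%:C <= 1 :> R[i] by rewrite -(rmorph1 (real_complex R)) lecR.
have r0 : 0 < r.
  rewrite subr_gt0; apply: (@le_lt_trans _ _ (`|a| ^+ 2)).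
    by rewrite ler_piMl // exprn_ge0.
  by rewrite exprn_ilt1.
pose u := (w - t%:C * a) / r.
have u1 : `|u| <= 1.
  by rewrite normrM normfV (gtr0_norm r0) ler_pdivrMr // mul1r.
have uK : u \in K.
  by rewrite inE; apply: KD; left; rewrite /closed_disk /closed_ball_ /= sub0r normrN.
have vK : a + (1 - `|a| ^+ 2) * u \in K.
  rewrite inE; apply: KD; right; rewrite /closed_disk /closed_ball_ /=.
  rewrite opprD addNKr normrN normrM ger0_norm; last first.
    by rewrite subr_ge0 exprn_ile1 // ltW.
  by rewrite ler_piMr // subr_ge0 exprn_ile1 // ltW.
have := Kc _ _ (Itv01 tC0 tC1) vK uK.
rewrite inE => hK.
suff <- : t%:C * (a + (1 - `|a| ^+ 2) * u) + (1 - t%:C) * u = w by exact: hK.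
have -> : w = u * r + t%:C * a by rewrite mulfVK ?subrK // gt_eqF.
by rewrite /r; ring.
Qed.

(** For the unit vector y = (1 + a^* A) x, the value is <B y, y> with B = (A + a)(1 + a^* A)^-1.
    Working with x avoids inverting 1 + a^* A. *)
Lemma mobius_numrange (R : realType) (U : lmodType R[i])
    (ip : {dot U for (@Num.conj R[i])}) (A : U -> U) (a : R[i]) (x : U) :
  (forall c u v, A (c *: u + v) = c *: A u + A v) ->
  (forall u, `|ip (A u) u| <= ip u u) ->
  `|a| < 1 -> ip (x + a^* *: A x) (x + a^* *: A x) = 1 ->
  teardrop a (ip (A x + a *: x) (x + a^* *: A x)).
Proof.
move=> Alin Aw a_lt1.
have A0 : A 0 = 0.
  by apply: (addIr (A 0)); rewrite add0r -{1}[A 0]scale1r -Alin scaler0 addr0.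
have AZ c u : A (c *: u) = c *: A u by rewrite -[c *: u]addr0 Alin A0 addr0.
have [->|x0] := eqVneq x 0.
  by rewrite A0 scaler0 addr0 linear0l => /esym/eqP; rewrite oner_eq0.
have [r [u [-> u1]]] : exists (r : R) u, x = r%:C *: u /\ ip u u = 1.
  have c0 : 0 < ip x x by rewrite dnorm_gt0.
  have cE : ip x x = (complex.Re (ip x x))%:C by rewrite RRe_real // gtr0_real.
  set c := complex.Re _ in cE; rewrite cE ltcR in c0.
  have s0 : Num.sqrt c != 0 by rewrite gt_eqF // sqrtr_gt0.
  exists (Num.sqrt c), ((Num.sqrt c)^-1%:C *: x); split.
    by rewrite scalerA -rmorphM mulfV // rmorph1 scale1r.
  rewrite !dotE conjC_realC cE -!rmorphM mulrA -expr2 exprVn sqr_sqrtr ?ltW //.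
  by rewrite mulVf ?rmorph1 // gt_eqF.
rewrite AZ.
have [p Aup] : exists p, ip (A u) u = p by exists (ip (A u) u).
have [q AuAu] : exists q : R, ip (A u) (A u) = q%:C.
  by exists (complex.Re (ip (A u) (A u))); rewrite RRe_real // ger0_real ?dnorm_ge0.
have uAu : ip u (A u) = p^* by rewrite dotC Aup.
have := numrange_bound _ _ ip A u p _ Alin Aw u1 Aup erefl.
rewrite AuAu !dotE !conjC_realC u1 Aup uAu AuAu conjCK.
set S := Num.sqrt _ => -[P1 /= /andP[Pq qS]].
have S0 : 0 <= S by exact: sqrtr_ge0.
have S2 : S ^+ 2 = 1 - (complex.Re p ^+ 2 + complex.Im p ^+ 2).
  by rewrite sqr_sqrtr // subr_ge0.
clearbody S; clear Aup uAu.
have aE := add_Re2_Im2 a.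
have a2 : complex.Re a ^+ 2 + complex.Im a ^+ 2 < 1.
  by rewrite -ltcR aE rmorph1 exprn_ilt1.
case: p P1 Pq S2 => p1 p2 /= P1 Pq S2.
case: a a_lt1 aE a2 => a1 a2 /= a_lt1 aE A2.
set N := 1 + 2 * (a1 * p1 + a2 * p2) + (a1 ^+ 2 + a2 ^+ 2) * q.
set n1 := p1 + a1 + a1 * q + ((a1 ^+ 2 - a2 ^+ 2) * p1 + 2 * a1 * a2 * p2).
set n2 := p2 + a2 + a2 * q + (2 * a1 * a2 * p1 - (a1 ^+ 2 - a2 ^+ 2) * p2).
have conjE (s t : R) : (s +i* t)^* = s -i* t by [].
move=> yy.
(* With x = r u, the normalisation turns the inner product r^2 (n1 + i n2) into the quotient bounded
   by [mobius_support]. *)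
have {yy} rN : r ^+ 2 * N = 1.
  apply: complexI; rewrite rmorph1 -{}yy !conjE.
  by apply/eqP; rewrite eq_complex /=; apply/andP; split; apply/eqP; rewrite /N; ring.
have N0 : 0 < N.
  by rewrite ltNge; apply/negP => hN; have := sqr_ge0 r; nra.
have NV : r ^+ 2 = N^-1 by rewrite -[LHS](mulfK (lt0r_neq0 N0)) rN mul1r.
have [t [t0 t1 ht]] := mobius_support _ _ _ _ _ _ _ A2 Pq S0 S2 qS N0.
set w := (X in teardrop _ X).
have wE : w = (n1 / N) +i* (n2 / N).
  rewrite -NV /w !conjE.
  by apply/eqP; rewrite eq_complex /=; apply/andP; split; apply/eqP; rewrite /n1 /n2; ring.
apply: (@teardrop_disk R _ _ t) => //; rewrite wE -aE.
have -> : (n1 / N) +i* (n2 / N) - t%:C * (a1 +i* a2) =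
   (n1 / N - t * a1) +i* (n2 / N - t * a2).
  by apply/eqP; rewrite eq_complex /=; apply/andP; split; apply/eqP; ring.
have -> : 1 - t%:C * (a1 ^+ 2 + a2 ^+ 2)%:C = (1 - t * (a1 ^+ 2 + a2 ^+ 2))%:C.
  by rewrite rmorphB rmorph1 rmorphM.
rewrite normc_def lecR /=.
have h0 : 0 <= 1 - t * (a1 ^+ 2 + a2 ^+ 2).
  rewrite subr_ge0 mulr_ile1 // ?addr_ge0 ?sqr_ge0 //; exact: ltW.
by rewrite -[leRHS]ger0_norm // -sqrtr_sqr ler_wsqrtr.
Qed.

(** * Polynomials of an operator *)

Section PolyOp.
Variables (R : realType) (H : completeNormedModType R[i]) (T : {linear H -> H}).
Implicit Types (p q : {poly R[i]}).

Lemma iter_linear k c u v : iter k T (c *: u + v) = c *: iter k T u + iter k T v.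
Proof. by elim: k => //= k ->; rewrite linearP. Qed.

Lemma poly_op_linear p c u v :
  poly_op T p (c *: u + v) = c *: poly_op T p u + poly_op T p v.
Proof.
rewrite /poly_op scaler_sumr -big_split; apply: eq_bigr => k _ /=.
by rewrite iter_linear scalerDr !scalerA mulrC.
Qed.

Lemma poly_op_scale p c u : poly_op T p (c *: u) = c *: poly_op T p u.
Proof.
rewrite /poly_op scaler_sumr; apply: eq_bigr => k _.
have -> : iter k T (c *: u) = c *: iter k T u.
  by elim: (nat_of_ord k) => //= j ->; rewrite linearZ.
by rewrite !scalerA mulrC.
Qed.

Lemma poly_op_widen n p x : (size p <= n)%N ->
  poly_op T p x = \sum_(k < n) p`_k *: iter k T x.
Proof.
move=> pn; rewrite /poly_op (big_ord_widen _ (fun k => p`_k *: iter k T x) pn).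
rewrite big_mkcond; apply: eq_bigr => k _; case: ltnP => // kp.
by rewrite nth_default // scale0r.
Qed.

Lemma poly_opD p q x : poly_op T (p + q) x = poly_op T p x + poly_op T q x.
Proof.
pose n := maxn (size p) (size q).
rewrite (@poly_op_widen n) ?size_polyD // (@poly_op_widen n p) ?leq_maxl //.
rewrite (@poly_op_widen n q) ?leq_maxr // -big_split; apply: eq_bigr => k _ /=.
by rewrite coefD scalerDl.
Qed.

Lemma poly_opZ c p x : poly_op T (c *: p) x = c *: poly_op T p x.
Proof.
rewrite (@poly_op_widen (size p)) ?size_scale_leq // /poly_op scaler_sumr.
by apply: eq_bigr => k _; rewrite coefZ scalerA.
Qed.

Lemma poly_opB p q x : poly_op T (p - q) x = poly_op T p x - poly_op T q x.
Proof. by rewrite -scaleN1r poly_opD poly_opZ scaleN1r. Qed.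

Lemma poly_op0 x : poly_op T 0 x = 0.
Proof. by rewrite -[0 in LHS](scale0r 0) poly_opZ scale0r. Qed.

Lemma poly_op1 x : poly_op T 1 x = x.
Proof. by rewrite /poly_op size_poly1 big_ord1 coef1 /= scale1r. Qed.

Lemma poly_opXM p x : poly_op T ('X * p) x = T (poly_op T p x).
Proof.
have h : (size ('X * p)%R <= (size p).+1)%N.
  by rewrite (leq_trans (size_polyMleq _ _)) // size_polyX.
rewrite (poly_op_widen _ _ _ h) big_ord_recl coefXM /= scale0r add0r.
rewrite linear_sum; apply: eq_bigr => k _.
by rewrite coefXM /= linearZ.
Qed.

Lemma poly_opM p q x : poly_op T (p * q) x = poly_op T p (poly_op T q x).
Proof.
elim/poly_ind: p x => [|p c IH] x; first by rewrite mul0r !poly_op0.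
rewrite mulrDl !poly_opD mulrAC [p * q * _]mulrC poly_opXM IH [p * 'X]mulrC poly_opXM.
by rewrite mul_polyC -[c%:P]alg_polyC !poly_opZ poly_op1.
Qed.

Lemma poly_op_XsubC z x : poly_op T ('X - z%:P) x = T x - z *: x.
Proof.
by rewrite poly_opB -['X]mulr1 poly_opXM -[z%:P]alg_polyC poly_opZ !poly_op1.
Qed.

(** The polynomial splits over the complex numbers, and each factor T - z is invertible. *)
Lemma poly_op_bij p : p != 0 -> (forall z, root p z -> ~ spectrum T z) ->
  exists g, cancel (poly_op T p) g /\ cancel g (poly_op T p).
Proof.
have [r pE] := closed_field_poly_normal p.
rewrite -lead_coef_eq0 => p0 pz.
have {pE} pE : p = (lead_coef p)%:P * \prod_(z <- r) ('X - z%:P) by rewrite mul_polyC.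
have {pz} rz z : z \in r -> ~ spectrum T z.
  by move=> zr; apply: pz; rewrite pE rootM root_prod_XsubC zr orbT.
rewrite {}pE; move: (lead_coef p) p0 => c c0 {p}.
elim: r rz => [|z r IH] rz.
  exists (fun x => c^-1 *: x).
  by split=> x; rewrite big_nil mulr1 -alg_polyC poly_opZ poly_op1 scalerA ?mulVf ?mulfV ?scale1r.
have [|g [g1 g2]] := IH; first by move=> y yr; apply: rz; rewrite inE yr orbT.
have /contrapT [B [_ B1 B2]] := rz z (mem_head _ _).
exists (g \o B); split=> x; rewrite big_cons mulrCA poly_opM poly_op_XsubC /=.
  by rewrite B1 g1.
by rewrite g2 B2.
Qed.

End PolyOp.

(** * Rational functions and reduced fractions *)

Section Rational.
Variable R : realType.
Implicit Types (p n d : {poly R[i]}) (f : {fraction {poly R[i]}}).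

Lemma horner_continuous p : continuous (horner p : R[i]^o -> R[i]^o).
Proof.
elim/poly_ind: p => [|p c IH].
  have -> : horner (0 : {poly R[i]}) = cst 0 by apply/funext => x; rewrite horner0.
  exact: cst_continuous.
have -> : horner (p * 'X + c%:P) = (fun x => p.[x] * x + c).
  by apply/funext => x; rewrite hornerMXaddC.
move=> z; have FF : Filter (nbhs (z : R[i]^o)) by exact: nbhs_filter.
have := @cvgM R[i] R[i]^o (nbhs (z : R[i]^o)) _ (horner p) id _ _ (IH z) cvg_id.
by move=> /(_ FF) h; exact: (@cvgD _ R[i]^o R[i]^o _ FF _ _ _ _ h (cvg_cst _)).
Qed.

Lemma closure_horner_le n d (S : set R[i]) (z : R[i]) :
  (forall s, S s -> `|n.[s]| <= `|d.[s]|) ->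
  closure (S : set R[i]^o) z -> `|n.[z]| <= `|d.[z]|.
Proof.
move=> le_nd Sz; rewrite real_leNgt ?normr_real //; apply/negP => lt_dn.
pose e := (`|n.[z]| - `|d.[z]|) / 2.
have e0 : 0 < e by rewrite divr_gt0 // subr_gt0.
have Hn : \forall s \near (z : R[i]^o), `|n.[z] - n.[s]| < e.
  by move: (horner_continuous n z) => /cvgr_dist_lt; apply.
have Hd : \forall s \near (z : R[i]^o), `|d.[s] - d.[z]| < e.
  by move: (horner_continuous d z) => /cvgr_distC_lt; apply.
have [s [Ss [hn hd]]] := Sz _ (filterI Hn Hd).
have ns : `|n.[z]| < e + `|n.[s]|.
  by rewrite -[n.[z]](subrK n.[s]) (le_lt_trans (ler_normD _ _)) // ltrD2r.
have ds : `|d.[s]| < e + `|d.[z]|.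
  by rewrite -[d.[s]](subrK d.[z]) (le_lt_trans (ler_normD _ _)) // ltrD2r.
have : `|n.[z]| < e + (e + `|d.[z]|).
  by apply: (lt_trans ns); rewrite ltrD2l (le_lt_trans (le_nd _ Ss)).
have -> : e + (e + `|d.[z]|) = `|n.[z]| by rewrite /e; field.
by rewrite ltxx.
Qed.

Lemma rat_fracE f : rat_den f != 0 /\ coprimep (rat_num f) (rat_den f).
Proof.
have d0 : (frac (repr f)).2 != 0 by exact: denom_ratioP.
have g0 : gcdp (frac (repr f)).1 (frac (repr f)).2 != 0.
  by rewrite gcdp_eq0 (negPf d0) andbF.
split; last by rewrite coprimep_div_gcd // d0 orbT.
by rewrite /rat_den dvdp_div_eq0 ?dvdp_gcdr.
Qed.

(** Cross-multiplication expresses f = n / d without fixing the representative chosen by [repr]. *)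
Lemma rat_of_polys n d : d != 0 ->
  exists f, rat_num f * d = rat_den f * n.
Proof.
move=> d0; pose r := Ratio n d.
pose f : {fraction {poly R[i]}} := \pi_({fraction {poly R[i]}})%qT r.
exists f.
have := FracField.equivf_l r; rewrite numer_Ratio // denom_Ratio // -/f.
have g0 : gcdp (frac (repr f)).1 (frac (repr f)).2 != 0.
  by rewrite gcdp_eq0 (negPf (denom_ratioP _)) andbF.
move=> E; apply: (mulIf g0).
rewrite mulrAC divpK ?dvdp_gcdl // mulrAC divpK ?dvdp_gcdr //.
Qed.

End Rational.

(** * Numerical estimates for the Moebius map and the teardrop *)

(** Homogeneous form of the invariance of the closed disk under a Moebius map. *)
Lemma mobius_normc_le (R : realType) (a n d : R[i]) :
  `|a| <= 1 -> `|n| <= `|d| -> `|n - a * d| <= `|d - a^* * n|.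
Proof.
move=> a1 nd; rewrite -(@ler_pXn2r _ 2) ?nnegrE // -subr_ge0.
have -> : `|d - a^* * n| ^+ 2 - `|n - a * d| ^+ 2 =
    (1 - `|a| ^+ 2) * (`|d| ^+ 2 - `|n| ^+ 2).
  by rewrite !normCK !rmorphB !rmorphM /= conjCK; ring.
by rewrite mulr_ge0 ?subr_ge0 ?exprn_ile1 // lerXn2r ?nnegrE.
Qed.

(** The disk of this radius about 0 is convex and contains both generating disks. The radius tends
    to 1 with |a|, which serves the limit case |f(z0)| = 1. *)
Lemma teardrop_norm_le (R : realType) (a w : R[i]) :
  `|a| <= 1 -> teardrop a w -> `|w| <= 1 + `|a| - `|a| ^+ 2.
Proof.
move=> a1 /(_ [set z | `|z| <= 1 + `|a| - `|a| ^+ 2]); apply; split.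
  move=> x y l; rewrite !inE /= => hx hy.
  have l0 : 0 <= l%:num :> R[i] by [].
  have l1 : 0 <= 1 - l%:num :> R[i] by rewrite subr_ge0.
  change (`|l%:num * x + (1 - l%:num) * y| <= 1 + `|a| - `|a| ^+ 2).
  rewrite (le_trans (ler_normD _ _)) // !normrM (ger0_norm l0) (ger0_norm l1).
  set c := 1 + _ - _ in hx hy *.
  have -> : c = l%:num * c + (1 - l%:num) * c by ring.
  by rewrite lerD // ler_wpM2l.
move=> z [|]; rewrite /closed_disk /closed_ball_ /=.
  rewrite sub0r normrN => h; rewrite (le_trans h) // -addrA lerDl subr_ge0.
  by rewrite expr2 ler_piMr.
move=> h; rewrite -[z](subrK a) (le_trans (ler_normD _ _)) // distrC.
by rewrite addrAC lerD2r.
Qed.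

(** * From W-spectral pairs to the teardrop *)

Section Main.
Variables (R : realType) (H : completeNormedModType R[i]).
Variable ip : {dot H for (@Num.conj R[i])}.
Hypothesis ip_norm : forall x : H, ip x x = `|x| ^+ 2.
Variables (T : {linear H -> H}) (S : set R[i]) (z0 : R[i]).
Hypotheses (S_z0 : S z0) (ST : W_spectral_pair ip T S z0).

Lemma ip_eq1 x : ip x x = 1 <-> `|x| = 1.
Proof.
rewrite ip_norm; split=> [|->]; last by rewrite expr1n.
by move=> /eqP; rewrite -[1 in X in X -> _](expr1n _ 2) eqrXn2 // => /eqP.
Qed.

Lemma numerical_radius_le1 (A : H -> H) :
  (forall c u v, A (c *: u + v) = c *: A u + A v) ->
  (numerical_radius ip A <= 1%:E)%E ->
  forall u, `|ip (A u) u| <= ip u u.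
Proof.
move=> Alin hA u.
have A0 : A 0 = 0.
  by apply: (addIr (A 0)); rewrite add0r -{1}[A 0]scale1r -Alin scaler0 addr0.
have [->|u0] := eqVneq u 0; first by rewrite A0 !linear0l normr0.
have n0 : 0 < `|u| by rewrite normr_gt0.
pose v := `|u|^-1 *: u.
have uv : u = `|u| *: v by rewrite /v scalerA mulfV ?scale1r ?gt_eqF.
have v1 : `|v| = 1 by rewrite normrZ normfV normr_id mulVf ?gt_eqF.
have Av : A u = `|u| *: A v by rewrite {1}uv -[_ *: v]addr0 Alin A0 addr0.
have : `|ip (A v) v| <= 1.
  have : ((complex.Re `|ip (A v) v|)%:E <= 1%:E)%E.
    apply: le_trans hA; apply: ereal_sup_ubound.
    by exists (ip (A v) v) => //; exists v.
  by rewrite lee_fin -(@lecR R) rmorph1 RRe_real ?normr_real.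
clearbody v; rewrite Av {2}uv !(dotE _ _ ip) (ip_norm u).
rewrite mulrA !normrM norm_conjC !normr_id -expr2.
by move=> h; rewrite ler_piMr // exprn_ge0.
Qed.

(** Injectivity makes the preimage chosen by [op_inv] the expected one. *)
Lemma rat_op_poly (f : {fraction {poly R[i]}}) u :
  injective (poly_op T (rat_den f)) ->
  rat_op f T (poly_op T (rat_den f) u) = poly_op T (rat_num f) u.
Proof.
move=> inj; rewrite /rat_op; congr poly_op; apply: inj.
by rewrite /op_inv; apply: (@xgetPex _ 0 [set y | _ y = _]); exists u.
Qed.

(** Stated for a coprime pair, so that it applies to r f as the pair (r n, d). The unit vector is
    written d(T) u, so f(T) sends it to n(T) u. *)
Lemma numrange_poly_ratio (n d : {poly R[i]}) (a : R[i]) u :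
  coprimep n d -> (forall z, S z -> `|n.[z]| <= `|d.[z]|) ->
  a = n.[z0] / d.[z0] -> `|a| < 1 ->
  `|poly_op T d u| = 1 ->
  teardrop a (ip (poly_op T n u) (poly_op T d u)).
Proof.
move=> cop nd aE a1 u1.
(* [m / k] is the Moebius transform of n / d that vanishes at z0; [g] below is its reduced form. *)
pose k := d - a^* *: n; pose m := n - a *: d.
have kz z : k.[z] = d.[z] - a^* * n.[z] by rewrite /k hornerD hornerN hornerZ.
have mz z : m.[z] = n.[z] - a * d.[z] by rewrite /m hornerD hornerN hornerZ.
have copz z : d.[z] = 0 -> n.[z] != 0.
  move=> dz; apply: contraTneq isT => nz.
  by have := coprimep_root cop (introT eqP nz); rewrite dz eqxx.
(* Were [z] a zero of [k] in the closure, [|d| = |a| |n| <= |a| |d|] would make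
   it a common zero of [n] and [d]. *)
have kS z : closure (S : set R[i]^o) z -> k.[z] != 0.
  move=> /(closure_horner_le _ _ _ _ _ nd) ndz; rewrite kz subr_eq0; apply/eqP => dE.
  have d0 : d.[z] = 0.
    apply/eqP; rewrite -normr_le0.
    have : `|d.[z]| <= `|a| * `|d.[z]|.
      by rewrite {1}dE normrM norm_conjC ler_wpM2l.
    rewrite -subr_ge0 -{2}[`|d.[z]|]mul1r -mulrBl nmulr_rge0 //; last by rewrite subr_lt0.
  by move: ndz (copz _ d0); rewrite d0 normr0 normr_le0 => /eqP->; rewrite eqxx.
have SS z : S z -> closure (S : set R[i]^o) z by exact: subset_closure.
have k0 : k != 0.
  by apply: contraTneq isT => k0; have := kS _ (SS _ S_z0); rewrite k0 horner0 eqxx.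
have [g gE] := rat_of_polys _ m _ k0.
have [gd0 gcop] := rat_fracE _ g.
have gk : rat_den g %| k.
  have : rat_den g %| rat_num g * k by rewrite gE dvdp_mulr.
  by rewrite Gauss_dvdpr // coprimep_sym.
have groot z : root (rat_den g) z -> k.[z] = 0.
  by move=> rz; apply/eqP; rewrite -/(root k z) -dvdp_XsubCl (dvdp_trans _ gk) // dvdp_XsubCl.
have gden z : S z -> (rat_den g).[z] != 0.
  by move=> Sz; apply: contra (kS _ (SS _ Sz)) => /groot ->.
have geval z : S z -> rat_eval g z = m.[z] / k.[z].
  move=> Sz; apply/eqP; rewrite eqr_div ?gden ?kS //; last exact: SS.
  by rewrite -!hornerM gE mulrC.
have d0 z : S z -> d.[z] != 0.
  move=> Sz; apply/eqP => dz; have := nd _ Sz; have := copz _ dz.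
  by rewrite dz normr0 normr_le0 => /negPf->.
have [G [G1 G2]] : exists G, cancel (poly_op T (rat_den g)) G /\
    cancel G (poly_op T (rat_den g)).
  apply: poly_op_bij => // z rz Tz; have := gden _ (ST.1 _ Tz).
  by rewrite (eqP rz) eqxx.
have inj : injective (poly_op T (rat_den g)) by exact: can_inj G1.
have Glin c v w : G (c *: v + w) = c *: G v + G w.
  by apply: inj; rewrite poly_op_linear !G2.
have AE v : rat_op g T v = poly_op T (rat_num g) (G v).
  by rewrite -{1}[v]G2 rat_op_poly.
have Alin c v w : rat_op g T (c *: v + w) = c *: rat_op g T v + rat_op g T w.
  by rewrite !AE Glin poly_op_linear.
have gle1 : (numerical_radius ip (rat_op g T) <= 1%:E)%E.
  apply: le_trans (ST.2 g _ _) _.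
  - by move=> z /groot kz0 /kS; rewrite kz0 eqxx.
  - by rewrite geval // mz aE divfK ?d0 // subrr mul0r.
  apply: ge_ereal_sup => _ [z Sz <-]; rewrite lee_fin -(@lecR R) rmorph1.
  rewrite RRe_real ?normr_real // geval // normrM normfV.
  rewrite ler_pdivrMr ?normr_gt0 ?kS //; last exact: SS.
  by rewrite mul1r mz kz mobius_normc_le ?nd // ltW.
have Aw := numerical_radius_le1 _ Alin gle1.
(* [e] is the factor cancelled in reducing m / k; restoring it gives g(T) k(T) = m(T). *)
have [e ke] : exists e, k = rat_den g * e.
  by exists (k %/ rat_den g); rewrite mulrC divpK.
have me : m = rat_num g * e.
  by apply: (mulfI gd0); rewrite -gE ke mulrCA.
have Ak v : rat_op g T (poly_op T k v) = poly_op T m v.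
  by rewrite ke me !poly_opM rat_op_poly.
(* Inverting the Moebius map: k + a^* m = l d and m + a k = l n, so x = k(T) u / l is carried to
   d(T) u by 1 + a^* A and to n(T) u by A + a. *)
pose l := 1 - `|a| ^+ 2.
have l0 : l != 0 by rewrite gt_eqF // subr_gt0 exprn_ilt1.
have lE : l = 1 - a * a^* by rewrite /l normCK.
pose x := poly_op T k (l^-1 *: u).
have xd : x + a^* *: rat_op g T x = poly_op T d u.
  rewrite /x Ak -poly_opZ -poly_opD.
  have -> : k + a^* *: m = l *: d.
    by rewrite /k /m lE scalerBr scalerA addrA subrK scalerBl scale1r mulrC.
  by rewrite poly_opZ poly_op_scale scalerA mulfV // scale1r.
have xn : rat_op g T x + a *: x = poly_op T n u.
  rewrite /x Ak -poly_opZ -poly_opD.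
  have -> : m + a *: k = l *: n.
    by rewrite /k /m lE scalerBr scalerA addrA subrK scalerBl scale1r.
  by rewrite poly_opZ poly_op_scale scalerA mulfV // scale1r.
have := mobius_numrange _ _ ip _ a x Alin Aw a1.
by rewrite xd xn; apply; apply/ip_eq1.
Qed.
End Main.

Theorem theorem1p7 (R : realType) (H : completeNormedModType R[i])
    (ip : {dot H for (@Num.conj R[i])})
    (ip_norm : forall x : H, ip x x = `|x| ^+ 2)
    (T : {linear H -> H}) (T_bounded : continuous T)
    (S : set R[i]) (z0 : R[i]) (S_z0 : S z0)
    (ST : W_spectral_pair ip T S z0)
    (f : {fraction {poly R[i]}}) (f_disk : rat_maps f S (closed_disk 0 1)) :
  numerical_range ip (rat_op f T) `<=` teardrop (rat_eval f z0).
Proof.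
move=> _ [y y1 ->].
have [d0 cop] := rat_fracE _ f.
have [G [G1 G2]] : exists G, cancel (poly_op T (rat_den f)) G /\
    cancel G (poly_op T (rat_den f)).
  by apply: poly_op_bij => // z rz Tz; have [] := f_disk _ (ST.1 _ Tz).
rewrite -(G2 y) in y1 *; move: (G y) y1 => u u1.
rewrite rat_op_poly; last exact: can_inj G1.
have f1 z : S z -> `|rat_eval f z| <= 1.
  by move=> /f_disk[_]; rewrite /closed_disk /closed_ball_ /= sub0r normrN.
have nd z : S z -> `|(rat_num f).[z]| <= `|(rat_den f).[z]|.
  move=> Sz; have [dz _] := f_disk _ Sz; have := f1 _ Sz.
  by rewrite /rat_eval normrM normfV ler_pdivrMr ?mul1r // normr_gt0; apply/negP.
have := f1 _ S_z0; rewrite le_eqVlt => /orP[/eqP a1|a1]; last first.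
  exact: (@numrange_poly_ratio _ _ _ ip_norm _ _ _ S_z0 ST _ (rat_den f)).
set w := ip _ _; set a := rat_eval f z0 in a1 *.
(* From here |a| = 1: r f takes the value r a at z0, of modulus r < 1. *)
have key (r : R) : 0 < r < 1 -> r%:C * `|w| <= 1 + r%:C - r%:C ^+ 2.
  move=> /andP[r0 r1].
  have rn : `|r%:C| = r%:C :> R[i] by rewrite ger0_norm // ler0c ltW.
  have rC1 : r%:C < 1 :> R[i] by rewrite -(rmorph1 (real_complex R)) ltcR.
  have ra : `|r%:C * a| = r%:C by rewrite normrM a1 mulr1 rn.
  have td : teardrop (r%:C * a) (ip (poly_op T (r%:C *: rat_num f) u) (poly_op T (rat_den f) u)).
    apply: (@numrange_poly_ratio _ _ _ ip_norm _ _ _ S_z0 ST) => //.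
    - by rewrite coprimepZl // gt_eqF // ltcR.
    - move=> z Sz; rewrite hornerZ normrM rn (le_trans _ (nd _ Sz)) //.
      by rewrite ler_piMl // ltW.
    - by rewrite hornerZ mulrA.
    - by rewrite ra.
  have := teardrop_norm_le _ _ _ _ td; rewrite ra poly_opZ (dotE _ _ ip) normrM rn.
  by apply; apply: ltW.
have w1 : `|w| <= 1.
  have wE : `|w| = (complex.Re `|w|)%:C by rewrite RRe_real ?normr_real.
  move: key; rewrite wE; set c := complex.Re _ => key.
  rewrite -(rmorph1 (real_complex R)) lecR leNgt; apply/negP => c1.
  (* [key] says c - 1 + (1 - r)^2 <= (1 - r)(c + 1), which fails when 1 - r = (c - 1) / (2 (c +
     1)). *)
  pose r := (c + 3) / (2 * (c + 1)).
  have c0 : 0 < 2 * (c + 1) by lra.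
  have r1 : r * (2 * (c + 1)) = c + 3 by rewrite /r divfK // gt_eqF.
  have r01 : 0 < r < 1.
    by rewrite /r divr_gt0 ?ltr_pdivrMr //; lra.
  have := key _ r01; rewrite -(rmorph1 (real_complex R)) -!rmorphM -rmorphXn -rmorphD -rmorphB lecR.
  move: r01 => /andP[r0 r_lt1]; nra.
move=> K [_ KD]; apply: KD; left.
by rewrite /closed_disk /closed_ball_ /= sub0r normrN.
Qed.
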